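(* Let $W,W'\in\mathbb{R}^{d_L\times d_0}$ be two matrices (not necessarily distinct) with $\operatorname{rk}W=\operatorname{rk}W'$, and let $\theta\in\mu^{-1}(W)$ and $\theta'\in\mu^{-1}(W')$ be two points that both have the same rank list. Then there is a linear bijection from $\mathbb{R}^{d_\theta}$ to $\mathbb{R}^{d_\theta}$ that maps $\theta$ to $\theta'$, maps $\mu^{-1}(W)$ onto $\mu^{-1}(W')$, and maps $S^W_{\underline{s}}$ onto $S^{W'}_{\underline{s}}$ for every stratum $S^W_{\underline{s}}$ in the rank stratification of $\mu^{-1}(W)$.
   Context: Fix integers $L\ge1$ and $d_0,\ldots,d_L\ge1$. The weight space is $\mathbb{R}^{d_\theta}=\mathbb{R}^{d_L\times d_{L-1}}\times\cdots\times\mathbb{R}^{d_1\times d_0}$, $d_\theta=\sum_{j=1}^Ld_jd_{j-1}$; a weight vector is $\theta=(W_L,\ldots,W_1)$ with $W_j\in\mathbb{R}^{d_j\times d_{j-1}}$. The matrix multiplication map is $\mu(\theta)=W_LW_{L-1}\cdots W_1$ and the fiber of $W$ is $\mu^{-1}(W)=\{\theta\in\mathbb{R}^{d_\theta}:\mu(\theta)=W\}$. For $L\ge k\ge i\ge0$, $W_{k\sim i}=W_kW_{k-1}\cdots W_{i+1}$, with $W_{k\sim k}=I_{d_k\times d_k}$. The rank list of $\theta$ is the family $\langle\operatorname{rk}W_{k\sim i}\rangle_{L\ge k\ge i\ge0}$. For a rank list $\underline{r}=\langle r_{k\sim i}\rangle$, the stratum $S^W_{\underline{r}}=\{\theta\in\mu^{-1}(W):\text{the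 rank list of }\theta\text{ is }\underline{r}\}$. The rank stratification of $\mu^{-1}(W)$ is the set of all $S^W_{\underline{r}}$ with $\underline{r}$ the rank list of some weight vector in $\mu^{-1}(W)$. *)

(* Defs.v *)
From HB Require Import structures.
From mathcomp Require Import all_boot all_order all_algebra.
From mathcomp Require Import boolp classical_sets reals.
Set Implicit Arguments.
Unset Strict Implicit.
Unset Printing Implicit Defensive.
Import GRing.Theory.
Local Open Scope ring_scope.
Local Open Scope classical_set_scope.

(* Only d 0, ..., d L are relevant: layer indices start at 0, so that the
   component of theta at j : 'I_L is the matrix W_(j+1), of size
   d_(j+1) x d_j. *)
Definition weight (R : fieldType) (L : nat) (d : nat -> nat) : Type :=
  {dffun forall j : 'I_L, 'M[R]_(d j.+1, d j)}.

Section WeightSpace.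
Variables (R : fieldType) (L : nat) (d : nat -> nat).
Local Notation weight := (weight R L d).
Implicit Types t u v : weight.

HB.instance Definition _ := Choice.on weight.

Definition weight_zero : weight := [ffun=> 0].
Definition weight_opp t : weight := [ffun j => - t j].
Definition weight_add t u : weight := [ffun j => t j + u j].
Definition weight_scale (a : R) t : weight := [ffun j => a *: t j].

Fact weight_addA : associative weight_add.
Proof. by move=> t u v; apply/ffunP => j; rewrite !ffunE addrA. Qed.
Fact weight_addC : commutative weight_add.
Proof. by move=> t u; apply/ffunP => j; rewrite !ffunE addrC. Qed.
Fact weight_add0 : left_id weight_zero weight_add.
Proof. by move=> t; apply/ffunP => j; rewrite !ffunE add0r. Qed.
Fact weight_addN : left_inverse weight_zero weight_opp weight_add.
Proof. by move=> t; apply/ffunP => j; rewrite !ffunE addNr. Qed.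

HB.instance Definition _ := GRing.isZmodule.Build weight
  weight_addA weight_addC weight_add0 weight_addN.

Fact weight_scaleA a b t :
  weight_scale a (weight_scale b t) = weight_scale (a * b) t.
Proof. by apply/ffunP => j; rewrite !ffunE scalerA. Qed.
Fact weight_scale1 : left_id 1 weight_scale.
Proof. by move=> t; apply/ffunP => j; rewrite !ffunE scale1r. Qed.
Fact weight_scaleDr : right_distributive weight_scale +%R.
Proof. by move=> a t u; apply/ffunP => j; rewrite !ffunE scalerDr. Qed.
Fact weight_scaleDl t : {morph weight_scale^~ t : a b / a + b}.
Proof. by move=> a b; apply/ffunP => j; rewrite !ffunE scalerDl. Qed.

HB.instance Definition _ := GRing.Zmodule_isLmodule.Build R weight
  weight_scaleA weight_scale1 weight_scaleDr weight_scaleDl.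

End WeightSpace.

Section Fibers.
Variables (R : fieldType) (L : nat) (d : nat -> nat).
Implicit Types (t : weight R L d) (W : 'M[R]_(d L, d 0%N)).

(* The matrix W_(j+1), extended by 0 to the out-of-range indices j >= L. *)
Definition layer t (j : nat) : 'M[R]_(d j.+1, d j) :=
  match @idP (j < L)%N with
  | ReflectT ltjL => t (Ordinal ltjL)
  | ReflectF _ => 0
  end.

(* W_(k~i) = W_k ... W_(i+1) for i <= k <= L. The types of 1%:M and of W_(k~k)
   only agree propositionally, hence pid_mx, which is the identity matrix when
   k = i; the values for k < i are irrelevant. *)
Fixpoint subprod t (k i : nat) : 'M[R]_(d k, d i) :=
  match k return 'M[R]_(d k, d i) with
  | 0%N => pid_mx (d i)
  | k'.+1 => if (i <= k')%N then layer t k' *m subprod t k' i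
             else pid_mx (d i)
  end.

Lemma layerE t (j : 'I_L) : layer t j = t j.
Proof.
rewrite /layer; case: {-}_ / idP => [lt_jL|/negP]; last by rewrite ltn_ord.
by case: j lt_jL => j p q /=; rewrite (bool_irrelevance q p).
Qed.

Lemma subprodkk t k : subprod t k k = 1%:M.
Proof. by case: k => [|k] /=; rewrite ?ltnn pid_mx_1. Qed.

Lemma subprodS t k i :
  (i <= k)%N -> subprod t k.+1 i = layer t k *m subprod t k i.
Proof. by move=> /= ->. Qed.

Definition mu t : 'M[R]_(d L, d 0%N) := subprod t L 0%N.

Definition fiber W : set (weight R L d) := [set t | mu t = W].

(* The pairs (k, i) with L >= k >= i >= 0. *)
Definition rank_index : Type := {ki : 'I_L.+1 * 'I_L.+1 | (ki.2 <= ki.1)%N}.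
HB.instance Definition _ := Finite.on rank_index.

Definition rank_list t : {ffun rank_index -> nat} :=
  [ffun ki : rank_index => \rank (subprod t (val ki).1 (val ki).2)].

Definition stratum W (r : {ffun rank_index -> nat}) : set (weight R L d) :=
  [set t | fiber W t /\ rank_list t = r].

Definition rank_stratification W : set (set (weight R L d)) :=
  [set stratum W (rank_list t) | t in fiber W].

End Fibers.

(* Main.v *)
Require Import Defs.
From HB Require Import structures.
From mathcomp Require Import all_boot all_order all_algebra.
From mathcomp Require Import boolp classical_sets reals.
Import GRing.Theory.
Local Open Scope ring_scope.
Local Open Scope classical_set_scope.

(** A weight vector is a representation of the linearly oriented quiver of type
    A, and such a representation is determined up to isomorphism by its rank
    list: there are invertible J_0, ..., J_L with J_(j+1) W'_(j+1) = W_(j+1) J_j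
    for all j, and then t |-> (J_(j+1)^-1 t_(j+1) J_j)_j is the desired
    bijection. With matrices acting on row vectors on the right, the row spaces
    of W_(L~i), W_(L-1~i), ..., W_(i~i) form a flag in the i-th space. The J_i
    are built by increasing i, each mapping the flag of theta to that of theta':
    J_(i+1) is a lift of J_i along W_(i+1), extended one flag step at a time. *)

(** * Lifting linear maps along flags of row spaces *)

(** Matrices of equal rank share the middle factor [pid_mx] in [mulmx_ebase]. Exchanging the row
    bases thus turns [A] into [B] up to an invertible left factor, which leaves the row space
    unchanged. *)
Lemma eq_rank_eqmx {K : fieldType} {m n : nat} (A B : 'M[K]_(m, n)) :
  \rank A = \rank B -> exists h : 'M_n, (A *m h :=: B)%MS.
Proof.
move=> rkAB; exists (invmx (row_ebase A) *m row_ebase B).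
have -> : A *m (invmx (row_ebase A) *m row_ebase B)
        = (col_ebase A *m invmx (col_ebase B)) *m B.
  rewrite -{1}[A]mulmx_ebase -{3}[B]mulmx_ebase -!mulmxA.
  by rewrite mulKVmx ?row_ebase_unit // mulKmx ?col_ebase_unit // rkAB.
apply: eqmxMfull; rewrite row_full_unit unitmx_mul unitmx_inv.
by rewrite !col_ebase_unit.
Qed.

(** One flag step: rank counts show that the parts of the two kernels not yet reached by the flag
    have equal dimension, so they can be matched separately from a lift of [g] on [G]. *)
Lemma extend_lift {K : fieldType} {m1 m2 n n0 : nat} (A A' : 'M[K]_(n, n0))
    (g : 'M_n0) (F F' : 'M_(m1, n)) (G G' : 'M_(m2, n)) (h : 'M_n) :
    (F <= G)%MS -> (F' <= G')%MS ->
    \rank F = \rank F' -> \rank G = \rank G' ->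
    \rank (F *m A) = \rank (F' *m A') -> \rank (G *m A) = \rank (G' *m A') ->
    (G *m A *m g :=: G' *m A')%MS ->
    (F *m h :=: F')%MS -> F *m h *m A' = F *m A *m g ->
  exists h2 : 'M_n,
    [/\ F *m h2 = F *m h, (G *m h2 :=: G')%MS & G *m h2 *m A' = G *m A *m g].
Proof.
move=> sFG sFG' rkF rkG rkFA rkGA eqGA eqFh FhA.
pose k := (G :&: kermx A)%MS; pose k' := (G' :&: kermx A')%MS.
(* [D] complements [k :&: F] in [k]: it is the part of the kernel on which [h] imposes nothing. *)
pose D := (k :\: F)%MS; pose D' := (k' :\: F')%MS.
(* Rank-nullity for [B] restricted to [Z], whose kernel part is already cut out by
   [X :&: kermx B]. *)
have rk_cap p m (X : 'M_(m, n)) (Z : 'M_(p, n)) (B : 'M[K]_(n, n0)) :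
    (Z <= X)%MS -> (\rank (Z *m B) + \rank ((X :&: kermx B) :&: Z) = \rank Z)%N.
  move=> sZX; rewrite -[RHS](mxrank_mul_ker Z B); congr (_ + _)%N.
  apply/eqmx_rank/andP; rewrite !sub_capmx !capmxSl !capmxSr.
  by rewrite (submx_trans (capmxSl _ _) (capmxSr _ _)) (submx_trans (capmxSl _ _) sZX).
have rkk : \rank k = \rank k'.
  apply: (@addnI (\rank (G *m A))).
  by rewrite mxrank_mul_ker rkGA mxrank_mul_ker.
have rkkF : \rank (k :&: F)%MS = \rank (k' :&: F')%MS.
  by apply: (@addnI (\rank (F *m A))); rewrite rk_cap // rkFA rk_cap.
have [e eqDe] : exists e, (D *m e :=: D')%MS.
  apply: eq_rank_eqmx; apply: (@addnI (\rank (k :&: F)%MS)).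
  by rewrite mxrank_cap_compl rkkF mxrank_cap_compl.
have sDk : (D <= k)%MS by apply: diffmxSl.
have sDk' : (D' <= k')%MS by apply: diffmxSl.
have sDG : (D <= G)%MS := submx_trans sDk (capmxSl _ _).
have sDG' : (D' <= G')%MS := submx_trans sDk' (capmxSl _ _).
have DA0 : D *m A = 0 by apply/sub_kermxP/(submx_trans sDk)/capmxSr.
have DA0' : D' *m A' = 0 by apply/sub_kermxP/(submx_trans sDk')/capmxSr.
have [p GpG] : exists p, G *m p *m G = G.
  by exists (pinvmx G); rewrite mulmxKpV.
have [q GAq] : exists q, G *m A *m g *m q *m (G' *m A') = G *m A *m g.
  by exists (pinvmx (G' *m A')); rewrite mulmxKpV ?eqGA.
(* [p] and [q] give coordinates with respect to the rows of [G] and of [G' *m A'], so [s] is a lift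
   with values in [G']. It need not agree with [h] on [F]. *)
have [s sG' GsA] : exists2 s, (s <= G')%MS & G *m s *m A' = G *m A *m g.
  exists (p *m (G *m A *m g *m q) *m G'); first exact: submxMl.
  by rewrite !mulmxA GpG -[LHS]mulmxA GAq.
have lift_s m (X : 'M_(m, n)) : (X <= G)%MS -> X *m s *m A' = X *m A *m g.
  case/submxP=> Y ->; rewrite -!mulmxA [G *m (s *m _)]mulmxA GsA.
  by rewrite -!mulmxA.
(* [proj_mx] takes square matrices, hence [<<F>>] in place of [F]. *)
have dxDF : (D :&: <<F>> = 0)%MS.
  by apply/eqP; rewrite -submx0 (cap_eqmx (eqmx_refl D) (genmxE F)) capmx_diff.
have dxFD : (<<F>> :&: D = 0)%MS by rewrite capmxC.
have [pF [/submxP[Y defpF] FpF DpF]] :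
    exists pF : 'M_n, [/\ (pF <= F)%MS, F *m pF = F & D *m pF = 0].
  exists (proj_mx <<F>>%MS D); rewrite proj_mx_id ?genmxE // proj_mx_0 //.
  by split=> //; rewrite -[X in (X <= _)%MS]mul1mx -(genmxE F) proj_mx_sub.
have [pD [/submxP[Z defpD] FpD DpD]] :
    exists pD : 'M_n, [/\ (pD <= D)%MS, F *m pD = 0 & D *m pD = D].
  exists (proj_mx D <<F>>%MS); rewrite proj_mx_0 ?genmxE // proj_mx_id //.
  by split=> //; rewrite -[X in (X <= _)%MS]mul1mx proj_mx_sub.
(* Both corrections to the lift s take values in ker A'; they make h2 agree
   with h on F and with e on D, so that the image of G contains k' = D' + (k' :&: F'). *)
pose h2 := s + pF *m (h - s) + pD *m (e - s).
have Fh2 : F *m h2 = F *m h.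
  by rewrite /h2 2![F *m (_ + _)]mulmxDr !mulmxA FpF FpD mul0mx addr0 -mulmxDr addrC subrK.
have Dh2 : D *m h2 = D *m e.
  by rewrite /h2 2![D *m (_ + _)]mulmxDr !mulmxA DpF DpD mul0mx addr0 -mulmxDr addrC subrK.
have Gh2A : G *m h2 *m A' = G *m A *m g.
  have pFA : pF *m (h - s) *m A' = 0.
    rewrite defpF -!mulmxA [F *m _]mulmxA mulmxBr mulmxBl FhA lift_s //.
    by rewrite subrr mulmx0.
  have pDA : pD *m (e - s) *m A' = 0.
    have DeA : D *m e *m A' = 0.
      have /submxP[Q ->] : (D *m e <= D')%MS by rewrite eqDe.
      by rewrite -mulmxA DA0' mulmx0.
    rewrite defpD -!mulmxA [D *m _]mulmxA mulmxBr mulmxBl DeA lift_s // DA0.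
    by rewrite mul0mx subrr mulmx0.
  by rewrite -mulmxA !mulmxDl pFA pDA !addr0 mulmxA lift_s.
have sGh2 : (G *m h2 <= G')%MS.
  have pFh : (pF *m h <= G')%MS by rewrite defpF -mulmxA mulmx_sub // eqFh.
  have pDe : (pD *m e <= G')%MS by rewrite defpD -mulmxA mulmx_sub // eqDe.
  by rewrite mulmx_sub // /h2 !mulmxBr !addmx_sub // eqmx_opp mulmx_sub.
exists h2; split=> //; apply/eqmxP; rewrite sGh2 /=.
have sF'h2 : (F' <= G *m h2)%MS by rewrite -eqFh -Fh2 submxMr.
have sD'h2 : (D' <= G *m h2)%MS by rewrite -eqDe -Dh2 submxMr.
have sk'h2 : (k' <= G *m h2)%MS.
  rewrite -(addsmx_diff_cap_eq k' F') addsmx_sub sD'h2 /=.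
  by rewrite (submx_trans (capmxSr _ _)).
(* The rows of [G'] agree with elements of [G *m h2] up to the kernel of [A']; the difference lies
   in [k'], which the image already contains. *)
have /submxP[Q defQ] : (G' *m A' <= G *m h2 *m A')%MS by rewrite Gh2A eqGA.
rewrite -[G'](subrK (Q *m (G *m h2))) addmx_sub ?submxMl //.
apply: submx_trans sk'h2; rewrite sub_capmx; apply/andP; split.
  by rewrite addmx_sub // eqmx_opp mulmx_sub.
by apply/sub_kermxP; rewrite mulmxBl defQ -!mulmxA subrr.
Qed.

(** Each new map agrees with the previous one on [F N], hence on all smaller members of the flag, so
    the earlier conclusions persist. *)
Lemma flag_lift {K : fieldType} {n n0 : nat} (m : nat -> nat)
    (A A' : 'M[K]_(n, n0)) (g : 'M_n0) (F F' : forall i, 'M_(m i, n)) (N : nat) :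
    (forall i j, (i <= j <= N)%N -> (F i <= F j)%MS) ->
    (forall i j, (i <= j <= N)%N -> (F' i <= F' j)%MS) ->
    (forall i, (i <= N)%N -> \rank (F i) = \rank (F' i)) ->
    (forall i, (i <= N)%N -> \rank (F i *m A) = \rank (F' i *m A')) ->
    (forall i, (i <= N)%N -> (F i *m A *m g :=: F' i *m A')%MS) ->
  exists h : 'M_n, forall i, (i <= N)%N ->
    (F i *m h :=: F' i)%MS /\ F i *m h *m A' = F i *m A *m g.
Proof.
elim: N => [|N IHN] subF subF' rkF rkFA eqFA.
  (* The flag is preceded by a member without rows, on which the zero map serves as [h]. *)
  have [|||||||||h [_ Fh hA]] := @extend_lift K 0 (m 0) n n0 A A' g 0 0
    (F 0) (F' 0) 0; rewrite ?sub0mx ?mul0mx ?mxrank0 //; try exact: rkF.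
  - exact: rkFA.
  - exact: eqFA.
  by exists h => i; rewrite leqn0 => /eqP ->.
have [|||||h IHh] := IHN.
- by move=> i j /andP[ij jN]; rewrite subF // ij leqW.
- by move=> i j /andP[ij jN]; rewrite subF' // ij leqW.
- by move=> i iN; rewrite rkF // leqW.
- by move=> i iN; rewrite rkFA // leqW.
- by move=> i iN; apply: eqFA; rewrite leqW.
have [eqFh hA] := IHh N (leqnn N).
have [|||||||||h2 [h2F Fh2 h2A]] := @extend_lift K _ _ n n0 A A' g (F N) (F' N)
    (F N.+1) (F' N.+1) h; rewrite ?subF ?subF' ?leqnSn ?leqnn //.
- exact/rkF/leqnSn.
- exact: rkF.
- exact/rkFA/leqnSn.
- exact: rkFA.
- exact: eqFA.
exists h2 => i; rewrite leq_eqVlt => /predU1P[-> //|]; rewrite ltnS => iN.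
have /submxP[Y defFi] : (F i <= F N)%MS by rewrite subF // iN leqnSn.
have -> : F i *m h2 = F i *m h by rewrite defFi -!mulmxA h2F.
exact: IHh.
Qed.

(** * Weight vectors with equal rank lists *)

Section WeightVectors.
Context {K : fieldType} {L : nat} {d : nat -> nat}.
Implicit Types t u : weight K L d.

Lemma subprodSr t k i :
  (i < k)%N -> subprod t k i.+1 *m layer t i = subprod t k i.
Proof.
elim: k => // k IHk; rewrite ltnS leq_eqVlt => /predU1P[->|ltik].
  by rewrite subprodkk subprodS // subprodkk mul1mx mulmx1.
by rewrite !subprodS ?(ltnW ltik) // -mulmxA IHk.
Qed.

Lemma subprod_sub t k l i :
  (i <= k <= l)%N -> (subprod t l i <= subprod t k i)%MS.
Proof.
case/andP=> ik; elim: l => [|l IHl]; first by rewrite leqn0 => /eqP ->.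
rewrite leq_eqVlt => /predU1P[-> //|]; rewrite ltnS => kl.
by rewrite subprodS ?(leq_trans ik) // mulmx_sub ?IHl.
Qed.

Lemma rank_listP t u :
  rank_list t = rank_list u <->
  forall k i, (i <= k <= L)%N -> \rank (subprod t k i) = \rank (subprod u k i).
Proof.
split=> [/ffunP eqr k i /andP[ik kL] | eqr]; last first.
  apply/ffunP => -[[k i] /= ik]; rewrite !ffunE /=.
  by rewrite eqr // ik -ltnS ltn_ord.
have kL1 : (k < L.+1)%N by [].
have iL1 : (i < L.+1)%N := leq_ltn_trans ik kL1.
by have := eqr (exist _ (Ordinal kL1, Ordinal iL1) ik); rewrite !ffunE.
Qed.

(** The largest flag member, at [k = n], is the whole space; this makes [h] invertible and the
    lifting equation hold everywhere. *)
Lemma flag_step t u (eqr : rank_list t = rank_list u) (n n0 : nat)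
    (A A' : 'M[K]_(d n, n0)) (g : 'M_n0) :
    (n <= L)%N ->
    (forall k, (n <= k <= L)%N ->
      \rank (subprod t k n *m A) = \rank (subprod u k n *m A')) ->
    (forall k, (n <= k <= L)%N ->
      (subprod t k n *m A *m g :=: subprod u k n *m A')%MS) ->
  exists2 h : 'M_(d n), h \in unitmx /\ h *m A' = A *m g &
    forall k, (n <= k <= L)%N -> (subprod t k n *m h :=: subprod u k n)%MS.
Proof.
move/rank_listP: eqr => eqr nL rkA eqA.
have bnd i : (i <= L - n)%N -> (n <= L - i <= L)%N.
  by move=> iN; rewrite leq_subr andbT -(subKn nL) leq_sub2l.
(* The row space of [subprod t k n] shrinks as [k] grows, so the flag is indexed by [L - k]. *)
have [|||||h hP] := @flag_lift K (d n) n0 (fun i => d (L - i)%N) A A' g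
  (fun i => subprod t (L - i) n) (fun i => subprod u (L - i) n) (L - n).
- move=> i j /andP[ij jN]; apply: subprod_sub.
  by case/andP: (bnd _ jN) => -> _; rewrite leq_sub2l.
- move=> i j /andP[ij jN]; apply: subprod_sub.
  by case/andP: (bnd _ jN) => -> _; rewrite leq_sub2l.
- by move=> i /bnd; apply: eqr.
- by move=> i /bnd; apply: rkA.
- by move=> i /bnd; apply: eqA.
have {}hP k : (n <= k <= L)%N -> (subprod t k n *m h :=: subprod u k n)%MS /\
    subprod t k n *m h *m A' = subprod t k n *m A *m g.
  case/andP=> nk kL; have := hP (L - k)%N (leq_sub2l _ nk).
  by rewrite subKn.
have [|] := hP n; first by rewrite leqnn.
rewrite !subprodkk !mul1mx => eqh1 hA; exists h => [|k /hP[]//].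
by split=> //; rewrite -row_full_unit -sub1mx eqh1.
Qed.

Lemma rank_list_isomorphic t u :
  rank_list t = rank_list u ->
  exists J : forall j, 'M[K]_(d j),
    (forall j, (j <= L)%N -> J j \in unitmx) /\
    (forall j, (j < L)%N -> J j.+1 *m layer u j = layer t j *m J j).
Proof.
move=> eqr; have /rank_listP rkP := eqr.
(* The third clause carries the induction: since [subprod t k n.+1 *m layer t n] is [subprod t k n],
   it is what [flag_step] requires at [n.+1]. *)
suff flagJ n : (n <= L)%N -> exists J : forall j, 'M[K]_(d j),
    [/\ forall j, (j <= n)%N -> J j \in unitmx,
        forall j, (j < n)%N -> J j.+1 *m layer u j = layer t j *m J j &
        forall k, (n <= k <= L)%N -> (subprod t k n *m J n :=: subprod u k n)%MS].
  by have [J [Ju JM _]] := flagJ L (leqnn L); exists J.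
elim: n => [|n IHn] nL.
  (* At index 0 there is nothing to lift: the target space has dimension 0. *)
  have [||h [hu _] hP] := @flag_step t u eqr 0 0 0 0 0 nL.
  - by move=> k _; rewrite !mulmx0.
  - by move=> k _; rewrite !mulmx0.
  (* The zero matrices are placeholders, overwritten one index at a time. *)
  exists (dfwith (fun j => 0 : 'M[K]_(d j)) h); rewrite !dfwith_in; split=> //.
  by move=> j; rewrite leqn0 => /eqP ->; rewrite dfwith_in.
have [J [Ju JM JP]] := IHn (ltnW nL).
have [||h [hu hM] hP] :=
  @flag_step t u eqr n.+1 (d n) (layer t n) (layer u n) (J n) nL.
- move=> k /andP[nk kL]; rewrite !subprodSr // rkP // kL ltnW //.
- move=> k /andP[nk kL]; rewrite !subprodSr //; apply: JP.
  by rewrite kL ltnW.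
exists (dfwith J h); rewrite dfwith_in; split=> //.
- move=> j; rewrite leq_eqVlt => /predU1P[->|]; first by rewrite dfwith_in.
  by rewrite ltnS => jn; rewrite dfwith_out ?Ju // gtn_eqF.
- move=> j; rewrite ltnS leq_eqVlt => /predU1P[->|jn].
    by rewrite dfwith_in dfwith_out ?gtn_eqF.
  by rewrite !dfwith_out ?JM // gtn_eqF // ltnS // ltnW.
Qed.

(** * Base change of weight vectors *)

(** Keeping [P] and [Q] separate lets the inverse be the same map with the two families exchanged,
    when they are mutually inverse up to index [L]. *)
Definition base_change (P Q : forall j, 'M[K]_(d j)) t : weight K L d :=
  [ffun j : 'I_L => P j.+1 *m t j *m Q j].

Fact base_change_is_linear P Q : linear (base_change P Q).
Proof.
move=> a t u; apply/ffunP => j; rewrite !ffunE.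
by rewrite mulmxDr mulmxDl -scalemxAr -scalemxAl.
Qed.

HB.instance Definition _ P Q := GRing.isLinear.Build K (weight K L d)
  (weight K L d) *:%R (base_change P Q) (base_change_is_linear P Q).

Lemma layer_base_change P Q t j :
  layer (base_change P Q t) j = P j.+1 *m layer t j *m Q j.
Proof.
have [jL|Lj] := ltnP j L.
  by rewrite -[j]/(nat_of_ord (Ordinal jL)) !layerE ffunE.
rewrite /layer; case: {-}_ / idP => [p|_]; last by rewrite mulmx0 mul0mx.
by have := p; rewrite ltnNge Lj.
Qed.

Lemma base_changeK P Q P' Q' :
  (forall j, (j <= L)%N -> P' j *m P j = 1%:M) ->
  (forall j, (j <= L)%N -> Q j *m Q' j = 1%:M) ->
  cancel (base_change P Q) (base_change P' Q').
Proof.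
move=> PK QK t; apply/ffunP => j; rewrite !ffunE !mulmxA PK //.
by rewrite mul1mx -mulmxA QK ?mulmx1 // ltnW.
Qed.

(** The product telescopes: each inner pair [Q j *m P j] cancels. *)
Lemma subprod_base_change P Q t k i :
  (forall j, (j <= L)%N -> Q j *m P j = 1%:M) ->
  (i <= k <= L)%N ->
  subprod (base_change P Q t) k i = P k *m subprod t k i *m Q i.
Proof.
move=> QP /andP[]; elim: k => [|k IHk].
  rewrite leqn0 => /eqP -> _; rewrite !subprodkk mulmx1.
  by rewrite (mulmx1C (QP _ _)).
rewrite leq_eqVlt => /predU1P[->|]; first move=> kL.
  by rewrite !subprodkk mulmx1 (mulmx1C (QP _ _)).
rewrite ltnS => ik kL; rewrite !subprodS // IHk ?(ltnW kL) //.
rewrite layer_base_change !mulmxA -[_ *m Q k *m P k]mulmxA QP ?mulmx1 //.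
exact: ltnW.
Qed.

End WeightVectors.

(** * Transport of fibers and strata *)

Theorem corollary14 (R : realType) (L : nat) (d : nat -> nat)
    (L_ge1 : (1 <= L)%N) (d_ge1 : forall j : nat, (j <= L)%N -> (1 <= d j)%N)
    (W W' : 'M[R]_(d L, d 0%N)) (rkWW' : \rank W = \rank W')
    (theta theta' : weight R L d)
    (theta_fiber : fiber W theta) (theta'_fiber : fiber W' theta')
    (same_rank_list : rank_list theta = rank_list theta') :
  exists f : {linear weight R L d -> weight R L d},
    [/\ bijective f,
        f theta = theta',
        f @` fiber W = fiber W' &
        forall s : {ffun rank_index L -> nat},
          rank_stratification W (stratum W s) ->
          f @` stratum W s = stratum W' s].
Proof.
have [J [Ju JM]] := rank_list_isomorphic _ _ same_rank_list.
pose I j := invmx (J j).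
have JI j : (j <= L)%N -> J j *m I j = 1%:M by move/Ju/mulmxV.
have IJ j : (j <= L)%N -> I j *m J j = 1%:M by move/Ju/mulVmx.
have fK : cancel (base_change I J) (base_change J I) := base_changeK _ _ _ _ JI JI.
have gK : cancel (base_change J I) (base_change I J) := base_changeK _ _ _ _ IJ IJ.
have ftheta : base_change I J theta = theta'.
  apply/ffunP => j; rewrite ffunE -!layerE -mulmxA -JM // mulmxA IJ //.
  by rewrite mul1mx.
have fiberE t : fiber W' (base_change I J t) <-> fiber W t.
  have muE u : mu (base_change I J u) = I L *m mu u *m J 0%N.
    by apply: subprod_base_change; rewrite // leqnn.
  (* Evaluating [mu] at [theta] and at its image [theta'] identifies [W']. *)
  have -> : W' = I L *m W *m J 0%N.
    by rewrite -theta'_fiber -theta_fiber -ftheta muE.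
  rewrite /fiber /= muE; split=> [|-> //] eqW.
  have : J L *m (I L *m mu t *m J 0%N) *m I 0%N
       = J L *m (I L *m W *m J 0%N) *m I 0%N by rewrite eqW.
  by rewrite !mulmxA JI // !mul1mx -!mulmxA JI // !mulmx1.
have rank_listE (t : weight R L d) : rank_list (base_change I J t) = rank_list t.
  apply/rank_listP => k i ikL; rewrite subprod_base_change //.
  case/andP: ikL => ik kL; have iL := leq_trans ik kL.
  have fullI : row_full (I k) by rewrite row_full_unit unitmx_inv; apply: Ju.
  by rewrite mxrankMfree ?row_free_unit ?Ju // (eqmxMfull _ fullI).
have fiber_inv t : fiber W' t -> fiber W (base_change J I t).
  by move=> W't; apply: (proj1 (fiberE _)); rewrite gK.
exists (base_change I J); split=> //.
- exact: Bijective fK gK.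
- apply/seteqP; split=> [_ [t Wt <-]|t W't]; first exact: (proj2 (fiberE t)).
  by exists (base_change J I t); [exact: fiber_inv|exact: gK].
- move=> s _; apply/seteqP; split=> [_ [t [Wt ts] <-]|t [W't ts]].
    by split; [exact: (proj2 (fiberE t))|rewrite rank_listE].
  exists (base_change J I t); last exact: gK.
  by split; [exact: fiber_inv|rewrite -ts -rank_listE gK].
Qed.
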